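(* Let $\mathbf V$ be a pseudovariety of monoids such that $\mathbf V=\mathbf A\circ_m\mathbf V$, where $\mathbf A$ is the pseudovariety of finite aperiodic monoids and $\circ_m$ denotes the Mal'cev product. If $\mathbf V$-pointlikes are decidable, then $\mathbf V$-idempotent pointlikes are decidable. In particular, $\mathbf A$-idempotent pointlikes are decidable.
   Context: A relational morphism $\varphi:M\to N$ of monoids assigns to each $m\in M$ a non-empty subset $m\varphi\subseteq N$ such that $1\in 1\varphi$ and $(m\varphi)(m'\varphi)\subseteq (mm')\varphi$. For $n\in N$, $n\varphi^{-1}=\{m\in M: n\in m\varphi\}$. The Mal'cev product $\mathbf A\circ_m\mathbf V$ is the pseudovariety of all finite monoids $M$ admitting a relational morphism $\varphi:M\to N$ with $N\in\mathbf V$ such that, for each idempotent $e\in N$, the semigroup $e\varphi^{-1}$ is aperiodic (all its subgroups are trivial). A subset $Z$ of a finite monoid $M$ is $\mathbf V$-pointlike if for every relational morphism $\varphi:M\to N$ with $N\in\mathbf V$ there exists $n\in N$ with $Z\subseteq n\varphi^{-1}$; it is $\mathbf V$-idempotent pointlike if for every such $\varphi$ there exists an idempotent $e\in N$ with $Z\subseteq e\varphi^{-1}$. ''$\mathbf V$-pointlikes (respectively $\mathbf V$-idempotent pointlikes) are decidable'' means that there is an algorithm which, given a finite monoid $M$ (by its multiplication table) and a subset $Z\subseteq M$, decides whether $Z$ is $\mathbf V$-pointlike (respectively $\mathbf V$-idempotent pointlike). *)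

(* Defs.v *)
From HB Require Import structures.
From mathcomp Require Import all_boot.

Set Implicit Arguments.
Unset Strict Implicit.
Unset Printing Implicit Defensive.

(** * Finite monoids and pseudovarieties *)

#[short(type="finMonoidType")]
HB.structure Definition FinMonoid := {M of Monoid M & Finite M}.
(* direct products [M * N] were given their instances before [FinMonoid] *)
HB.saturate prod.

(** A class of finite monoids closed under finite direct products (the empty
    product being the trivial monoid), submonoids and homomorphic images;
    invariance under isomorphism is the bijective case of either of the last
    two. *)
Record pseudovariety (V : finMonoidType -> Prop) : Prop := {
  pv_trivial : forall M : finMonoidType, #|M| = 1 -> V M;
  pv_prod : forall M N : finMonoidType, V M -> V N -> V (M * N)%type;
  pv_sub : forall (M N : finMonoidType) (f : M -> N),
    monoid_morphism f -> injective f -> V N -> V M;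
  pv_image : forall (M N : finMonoidType) (f : M -> N),
    monoid_morphism f -> (forall y, exists x, f x = y) -> V M -> V N
}.

(** * Relational morphisms and pointlike sets *)

Record relational_morphism (M N : finMonoidType) (phi : M -> {set N}) : Prop := {
  rm_nonempty : forall m, phi m != set0;
  rm_one : 1%g \in phi 1%g;
  rm_mul : forall m m' n n',
    n \in phi m -> n' \in phi m' -> (n * n')%g \in phi (m * m')%g
}.

Definition rel_preim (M N : finMonoidType) (phi : M -> {set N}) (n : N) : {set M} :=
  [set m | n \in phi m].

Definition idempotent (N : finMonoidType) (e : N) : Prop := (e * e)%g = e.

Definition pointlike (V : finMonoidType -> Prop) (M : finMonoidType) (Z : {set M}) : Prop :=
  forall (N : finMonoidType) (phi : M -> {set N}),
    V N -> relational_morphism phi ->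
    exists n : N, Z \subset rel_preim phi n.

Definition idempotent_pointlike (V : finMonoidType -> Prop) (M : finMonoidType)
    (Z : {set M}) : Prop :=
  forall (N : finMonoidType) (phi : M -> {set N}),
    V N -> relational_morphism phi ->
    exists2 e : N, idempotent e & Z \subset rel_preim phi e.

(** * Aperiodicity and the Mal'cev product *)

(** [G] is a group under the multiplication of [M]; its identity [u] need not
    be the identity of [M]. *)
Definition is_subgroup (M : finMonoidType) (G : {set M}) : Prop :=
  mulg_closed G /\
  exists2 u : M, u \in G &
    forall x, x \in G ->
      (u * x = x)%g /\ (x * u = x)%g /\
      exists2 y : M, y \in G & (x * y = u)%g /\ (y * x = u)%g.

Definition aperiodic (M : finMonoidType) (S : {set M}) : Prop :=
  forall G : {set M}, G \subset S -> is_subgroup G -> #|G| = 1.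

Definition aperiodic_monoid (M : finMonoidType) : Prop := aperiodic [set: M].

Definition aperiodic_malcev (V : finMonoidType -> Prop) (M : finMonoidType) : Prop :=
  exists (N : finMonoidType) (phi : M -> {set N}),
    [/\ V N, relational_morphism phi &
        forall e : N, idempotent e -> aperiodic (rel_preim phi e)].

(** * Algorithms *)

(** The total recursive functions on tuples of natural numbers: the least class
    containing zero, successor and projections that is closed under
    composition, primitive recursion, and minimization of functions having a
    zero for every value of the parameters. *)
Inductive recursive : forall k : nat, (k.-tuple nat -> nat) -> Prop :=
| Rec_zero : recursive (fun _ : 0.-tuple nat => 0)
| Rec_succ : recursive (fun v : 1.-tuple nat => (thead v).+1)
| Rec_proj k (i : 'I_k) : recursive (fun v : k.-tuple nat => tnth v i)
| Rec_comp k l (f : l.-tuple nat -> nat) (g : 'I_l -> k.-tuple nat -> nat) :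
    recursive f -> (forall i, recursive (g i)) ->
    recursive (fun v : k.-tuple nat => f [tuple g i v | i < l])
| Rec_prim k (f : k.-tuple nat -> nat) (g : k.+2.-tuple nat -> nat)
    (h : k.+1.-tuple nat -> nat) :
    recursive f -> recursive g ->
    (forall v : k.-tuple nat, h [tuple of 0 :: v] = f v) ->
    (forall n (v : k.-tuple nat),
      h [tuple of n.+1 :: v] = g [tuple of n :: h [tuple of n :: v] :: v]) ->
    recursive h
| Rec_min k (f : k.+1.-tuple nat -> nat) (h : k.-tuple nat -> nat) :
    recursive f ->
    (forall v : k.-tuple nat, f [tuple of h v :: v] = 0) ->
    (forall (v : k.-tuple nat) n, n < h v -> f [tuple of n :: v] <> 0) ->
    recursive h.

(** A finite monoid is presented by numbering its elements [0, ..., n - 1] in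
    an arbitrary way; the entries of the resulting n x n multiplication table,
    read row by row, are the base-[n] digits of [table_code r] (least
    significant first). *)
Definition table_code (M : finMonoidType) (n : nat) (r : M -> 'I_n) : nat :=
  \sum_(x : M) \sum_(y : M) r (x * y)%g * n ^ (r x * n + r y).

Definition subset_code (M : finMonoidType) (n : nat) (r : M -> 'I_n) (Z : {set M}) : nat :=
  \sum_(x in Z) 2 ^ r x.

Definition decidable_subsets (P : forall M : finMonoidType, {set M} -> Prop) : Prop :=
  exists2 f : 3.-tuple nat -> nat, recursive f &
    forall (M : finMonoidType) (n : nat) (r : M -> 'I_n), bijective r ->
    forall Z : {set M},
      f [tuple n; table_code r; subset_code r Z] = 1 <-> P M Z.

(* Main.v *)
From HB Require Import structures.
Require Import Defs.
From mathcomp Require Import all_boot.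
From mathcomp Require Import boolp zify.

(** If [V] is closed under the Mal'cev product with [A], then [Z] is V-idempotent
    pointlike if and only if [Z] lies in a V-pointlike set [E] with [E E = E], which
    can be searched for with an oracle for V-pointlikes. Given [phi : M -> N], the
    monoid of pairs (value, values of the two-factor factorizations) over [N] is again
    in [V], since the preimages of idempotents under its projection to [N] are
    aperiodic; and the preimage of an idempotent of it lies in [X X], where [X] is the
    preimage under [phi] of an idempotent of [N]. Iterating, one reaches the stable
    power of [X], which is the required [E] when the preimages under [phi] are
    pointlike.

    For [V = A], pointlikes are decidable by Henckell's theorem: [Z] is pointlike if and
    only if every family of subsets of [M] that contains the singletons and is closed
    under products and under bounding the cyclic groups it contains has a member that
    contains [Z]. An aperiodic monoid witnessing this is built by induction on the family,
    seen as an ordered monoid: words are cut at the occurrences of a non-invertible letter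
    [a], and the blocks between them are evaluated in the local divisor at [a], which is
    smaller. *)

Set Implicit Arguments.
Unset Strict Implicit.
Unset Printing Implicit Defensive.

(** * Recursive functions *)

Lemma recursive_ext k (f g : k.-tuple nat -> nat) : f =1 g -> recursive f -> recursive g.
Proof. by move/funext->. Qed.

(** Functions of an environment of arbitrary length, absent entries being read
    as [0]; a bounded quantifier pushes its variable on the environment. *)
Definition computable (F : seq nat -> nat) : Prop :=
  forall k, recursive (fun v : k.-tuple nat => F v).

Lemma computable_ext F G : F =1 G -> computable F -> computable G.
Proof. by move/funext->. Qed.

Lemma recursive_const k c : recursive (fun _ : k.-tuple nat => c).
Proof.
elim: c => [|c IHc].
  apply: recursive_ext (Rec_comp (g := fun i : 'I_0 => fun _ : k.-tuple nat => 0) Rec_zero _) => //.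
  by case.
by apply: recursive_ext (Rec_comp (g := fun i : 'I_1 => fun _ : k.-tuple nat => c) Rec_succ
  (fun=> IHc)) => v; rewrite /thead tnth_mktuple.
Qed.

Lemma computable_const c : computable (fun=> c).
Proof. by move=> k; exact: recursive_const. Qed.

Lemma computable_nth i : computable (fun s => nth 0 s i).
Proof.
move=> k; have [ik|ki] := ltnP i k.
  by apply: recursive_ext (Rec_proj (Ordinal ik)) => v; rewrite (tnth_nth 0).
by apply: recursive_ext (recursive_const _ 0) => v; rewrite nth_default // size_tuple.
Qed.

Lemma computable_head : computable (head 0).
Proof. by apply: computable_ext (computable_nth 0) => s; rewrite nth0. Qed.

Lemma computable_behead F : computable F -> computable (fun s => F (behead s)).
Proof.
move=> cF k; pose g (i : 'I_k.-1) (v : k.-tuple nat) := nth 0 v i.+1.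
apply: recursive_ext (Rec_comp (g := g) (cF k.-1) (fun i => computable_nth _ _)) => v /=.
congr F; apply: (@eq_from_nth _ 0); rewrite /= size_map ?size_enum_ord ?size_behead ?size_tuple//.
move=> i ik; rewrite nth_behead (nth_map (Ordinal ik)) ?size_enum_ord//.
by rewrite /g nth_enum_ord.
Qed.

Lemma computable_comp l (f : l.-tuple nat -> nat) (F : 'I_l -> seq nat -> nat) :
  recursive f -> (forall i, computable (F i)) ->
  computable (fun s => f [tuple F i s | i < l]).
Proof.
by move=> rf cF k; apply: (Rec_comp (g := fun i (v : k.-tuple nat) => F i v) rf) => i; exact: cF.
Qed.

Lemma computable3 (f : 3.-tuple nat -> nat) F G H : recursive f ->
  computable F -> computable G -> computable H ->
  computable (fun s => f [tuple F s; G s; H s]).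
Proof.
move=> rf cF cG cH.
pose K (i : 'I_3) (s : seq nat) := nth 0 [:: F s; G s; H s] i.
have cK i : computable (K i) by case: i => [[|[|[|//]]] ?].
apply: computable_ext (computable_comp rf cK) => s.
by congr f; apply: eq_from_tnth => -[[|[|[|//]]] ?]; rewrite tnth_mktuple (tnth_nth 0).
Qed.

Lemma computable_succ F : computable F -> computable (fun s => (F s).+1).
Proof.
move=> cF; apply: computable_ext (computable_comp (F := fun=> F) Rec_succ (fun=> cF)) => s.
by rewrite /thead tnth_mktuple.
Qed.

Lemma computable_rec F (G : nat -> nat -> seq nat -> nat) (H : seq nat -> nat) :
  computable F -> 
  computable (fun s => G (head 0 s) (head 0 (behead s)) (behead (behead s))) ->
  computable H ->
  computable (fun s => nat_rec (fun=> nat) (F s) (fun n r => G n r s) (H s)).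
Proof.
move=> cF cG cH k.
pose h (v : k.+1.-tuple nat) :=
  nat_rec (fun=> nat) (F (behead v)) (fun n r => G n r (behead v)) (head 0 v).
have rh : recursive h by apply: Rec_prim (cF k) (cG k.+2) _ _ .
pose g (i : 'I_k.+1) (v : k.-tuple nat) := if i : nat is j.+1 then nth 0 v j else H v.
have rg i : recursive (g i).
  by case: i => [[|j] ij]; [exact: cH|exact: computable_nth].
apply: recursive_ext (Rec_comp rh rg) => v; rewrite /h.
have -> : tval [tuple g i v | i < k.+1] = H v :: v.
  apply: (@eq_from_nth _ 0); rewrite /= size_map ?size_enum_ord ?size_tuple//.
  move=> i ik; rewrite (nth_map (Ordinal ik)) ?size_enum_ord//.
  by rewrite /g nth_enum_ord //; case: i {ik}.
by [].
Qed.

(** In the step of a recursion the environment starts with the counter and the accumulator; with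
    [m = 2] this discards both and puts the counter back, as the body of a bounded quantifier
    expects. *)
Lemma computable_cons_drop m F G : computable F -> computable G ->
  computable (fun s => G (F s :: drop m s)).
Proof.
move=> cF cG k.
pose g (i : 'I_(k - m).+1) (v : k.-tuple nat) := if i : nat is j.+1 then nth 0 v (m + j) else F v.
have rg i : recursive (g i).
  by case: i => [[|j] ij]; [exact: cF|exact: computable_nth].
apply: recursive_ext (Rec_comp (cG (k - m).+1) rg) => v.
congr G; apply: (@eq_from_nth _ 0); rewrite /= size_map ?size_enum_ord ?size_drop ?size_tuple//.
move=> i ik; rewrite (nth_map (Ordinal ik)) ?size_enum_ord//.
by rewrite /g nth_enum_ord //; case: i {ik} => //= j; rewrite nth_drop.
Qed.

Lemma computable_add F G : computable F -> computable G -> computable (fun s => F s + G s).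
Proof.
move=> cF cG; apply: computable_ext (computable_rec (G := fun _ r _ => r.+1) cF _ cG).
  by move=> s; elim: (G s) => /= [|n ->]; rewrite ?addn0 ?addnS.
exact/computable_succ/(computable_behead computable_head).
Qed.

Lemma computable_pred F : computable F -> computable (fun s => (F s).-1).
Proof.
move=> cF; apply: computable_ext (computable_rec (G := fun n _ _ => n) (computable_const 0) _ cF).
  by move=> s; case: (F s).
exact: computable_head.
Qed.

Lemma computable_sub F G : computable F -> computable G -> computable (fun s => F s - G s).
Proof.
move=> cF cG; apply: computable_ext (computable_rec (G := fun _ r _ => r.-1) cF _ cG).
  by move=> s; elim: (G s) => /= [|n ->]; rewrite ?subn0 ?subnS.
exact/computable_pred/(computable_behead computable_head).
Qed.

Lemma computable_mul F G : computable F -> computable G -> computable (fun s => F s * G s).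
Proof.
move=> cF cG.
apply: computable_ext (computable_rec (G := fun _ r s => G s + r) (computable_const 0) _ cF).
  by move=> s; elim: (F s) => //= n ->; rewrite mulSn.
apply: computable_add; last exact/computable_behead/computable_head.
exact: (computable_behead (computable_behead _)).
Qed.

Lemma computable_exp F G : computable F -> computable G -> computable (fun s => F s ^ G s).
Proof.
move=> cF cG.
apply: computable_ext (computable_rec (G := fun _ r s => F s * r) (computable_const 1) _ cG).
  by move=> s; elim: (G s) => //= n ->; rewrite expnS.
apply: computable_mul; last exact/computable_behead/computable_head.
exact: (computable_behead (computable_behead _)).
Qed.

Lemma computable_negb (P : seq nat -> bool) : computable P -> computable (fun s => ~~ P s).
Proof.
by move=> cP; apply: computable_ext (computable_sub (computable_const 1) cP) => s; case: (P s).
Qed.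

Lemma computable_andb (P Q : seq nat -> bool) :
  computable P -> computable Q -> computable (fun s => P s && Q s).
Proof. by move=> cP cQ; apply: computable_ext (computable_mul cP cQ) => s; rewrite mulnb. Qed.

Lemma computable_implb (P Q : seq nat -> bool) :
  computable P -> computable Q -> computable (fun s => P s ==> Q s).
Proof.
move=> cP cQ.
apply: computable_ext (computable_negb (computable_andb cP (computable_negb cQ))) => s.
by rewrite negb_and negbK implybE.
Qed.

Lemma computable_leq F G : computable F -> computable G -> computable (fun s => F s <= G s).
Proof.
move=> cF cG.
apply: computable_ext (computable_sub (computable_const 1) (computable_sub cF cG)) => s.
by rewrite -subn_eq0; case: (F s - G s).
Qed.

Lemma computable_eqn F G : computable F -> computable G -> computable (fun s => F s == G s).
Proof.
move=> cF cG; apply: computable_ext (computable_andb (computable_leq cF cG) (computable_leq cG cF)).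
by move=> s; rewrite eqn_leq.
Qed.

Lemma computable_eqb (P Q : seq nat -> bool) :
  computable P -> computable Q -> computable (fun s => P s == Q s).
Proof.
by move=> cP cQ; apply: computable_ext (computable_eqn cP cQ) => s; case: (P s) (Q s) => [] [].
Qed.

Lemma computable_all F (P : nat -> seq nat -> bool) :
  computable F -> computable (fun s => P (head 0 s) (behead s)) ->
  computable (fun s => all (P^~ s) (iota 0 (F s))).
Proof.
move=> cF cP.
apply: computable_ext (computable_rec (G := fun n r s => r * P n s) (computable_const 1) _ cF).
  by move=> s; elim: (F s) => // n IHn; rewrite -[in RHS]addn1 iotaD all_cat /= IHn andbT mulnb.
apply: computable_mul; first exact/computable_behead/computable_head.
apply: computable_ext (computable_cons_drop 2 computable_head cP) => s.
by rewrite /= -!drop1 drop_drop.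
Qed.

Lemma computable_has F (P : nat -> seq nat -> bool) :
  computable F -> computable (fun s => P (head 0 s) (behead s)) ->
  computable (fun s => has (P^~ s) (iota 0 (F s))).
Proof.
move=> cF cP.
have cN := computable_all (P := fun n s => ~~ P n s) cF (computable_negb cP).
apply: computable_ext (computable_negb cN) => s.
by rewrite -has_predC; congr (_ _); apply: eq_has => n /=; rewrite negbK.
Qed.

Lemma computable_divn F G : computable F -> computable G -> computable (fun s => F s %/ G s).
Proof.
(* The quotient counts the [k] with [0 < k <= F s] and [k * G s <= F s]; the guard [0 < G s] agrees
   with the convention that division by zero gives [0]. *)
move=> cF cG; pose step n r s := r + ((0 < G s) && (n.+1 * G s <= F s)).
apply: computable_ext (computable_rec (G := step) (computable_const 0) _ cF).
  (* Stopping the count at [n] gives [minn n (F s %/ G s)], the invariant of the induction. *)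
  move=> s; rewrite -[RHS](minn_idPr (leq_div (F s) (G s))).
  elim: {1 2}(F s) => [|n /= ->]; first by rewrite min0n.
  rewrite /step; have [->|G0] := posnP (G s); first by rewrite divn0 !minn0.
  by rewrite -leq_divRL //=; lia.
have cn := computable_head; have cr := computable_behead computable_head.
have cF2 := computable_behead (computable_behead cF).
have cG2 := computable_behead (computable_behead cG).
apply: computable_add cr _; apply: computable_andb; apply: computable_leq => //.
  exact: computable_const.
exact/computable_mul/cG2/computable_succ.
Qed.

Lemma computable_modn F G : computable F -> computable G -> computable (fun s => F s %% G s).
Proof.
move=> cF cG.
apply: computable_ext (computable_sub cF (computable_mul (computable_divn cF cG) cG)) => s.
by rewrite {1}(divn_eq (F s) (G s)) addKn.
Qed.

(* After a bounded quantifier has introduced a new head of the environment,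
   move the hypotheses to its tail. *)
Ltac computable_shift :=
  repeat match goal with H : computable _ |- _ =>
    generalize (computable_behead H); clear H end;
  generalize computable_head; intros.

Ltac computable_step := fail.

Ltac computability :=
  first
  [ assumption
  | apply computable_head
  | apply computable_const
  | computable_step; computability
  | apply computable_andb; computability
  | apply computable_implb; computability
  | apply computable_leq; computability
  | apply computable_eqn; computability
  | apply computable_eqb; computability
  | apply computable_add; computability
  | apply computable_mul; computability
  | apply computable_exp; computability
  | apply computable_divn; computability
  | apply computable_modn; computability
  | apply computable3; computability
  | apply computable_all; [computability | computable_shift; computability]
  | apply computable_has; [computability | computable_shift; computability] ].

(** * Digits and binary codes of finite sets *)

Definition digit b t i := (t %/ b ^ i) %% b.
Definition bit X i := digit 2 X i == 1.

Lemma computable_digit B T I : computable B -> computable T -> computable I ->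
  computable (fun s => digit (B s) (T s) (I s)).
Proof. by rewrite /digit => *; computability. Qed.

Lemma computable_bit X I : computable X -> computable I -> computable (fun s => bit (X s) (I s)).
Proof. by rewrite /bit /digit => *; computability. Qed.

Section Digits.
Variables (I : finType) (e : I -> nat) (b : nat) (d : I -> nat).
Hypotheses (e_inj : injective e) (b_gt0 : 0 < b) (d_lt : forall i, d i < b).

(** As [e] is injective, at most one index has exponent [k], and its term is at most
    [(b - 1) * b ^ k]. *)
Lemma sum_digits_lt k : \sum_(i | e i < k) d i * b ^ e i < b ^ k.
Proof.
elim: k => [|k IHk]; first by rewrite big_pred0.
rewrite (bigID (fun i => e i < k)) /=.
rewrite (eq_bigl (fun i => e i < k)); last by move=> i; lia.
have [j /eqP ej|noj] := pickP (fun i => e i == k).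
  rewrite [X in _ + X](big_pred1 j); last by move=> i /=; rewrite -(inj_eq e_inj) ej; lia.
  have := d_lt j; rewrite expnS ej => lt_dj.
  apply: (@leq_trans (b ^ k + d j * b ^ k)); first by rewrite ltn_add2r.
  by rewrite -mulSn leq_mul2r lt_dj orbT.
rewrite [X in _ + X]big_pred0 ?addn0; last by move=> i; have := noj i => /= /eqP; lia.
by apply: leq_trans IHk _; rewrite leq_pexp2l.
Qed.

(** Division by [b ^ e j] removes the terms of smaller exponent, whose sum is less than [b ^ e j];
    the terms of larger exponent vanish modulo [b]. *)
Lemma digit_sum j : digit b (\sum_i d i * b ^ e i) (e j) = d j.
Proof.
rewrite (bigID (fun i => e i < e j)) /=.
rewrite [X in _ + X](bigD1 j) ?ltnn //=.
pose q := \sum_(i | ~~ (e i < e j) && (i != j)) d i * b ^ (e i - (e j).+1).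
have -> : \sum_(i | ~~ (e i < e j) && (i != j)) d i * b ^ e i = b ^ e j * (b * q).
  rewrite /q !big_distrr /=; apply: eq_bigr => i /andP[ji]; rewrite -(inj_eq e_inj) => ij.
  by rewrite mulnA -expnSr mulnCA -expnD subnKC//; lia.
rewrite [d j * _]mulnC -mulnDr /digit addnC mulnC divnMDl ?expn_gt0 ?b_gt0//.
by rewrite divn_small ?sum_digits_lt// addn0 addnC mulnC modnMDl modn_small.
Qed.
End Digits.

Section Code.
Variables (T : finType) (n : nat) (c : T -> 'I_n).
Implicit Types A B : {set T}.
Hypothesis c_bij : bijective c.
Let c_inj : injective (fun x => c x : nat).
Proof. by move=> x y /val_inj; exact: bij_inj. Qed.

Definition code A : nat := \sum_(x in A) 2 ^ c x.

Let codeE A : code A = \sum_x (x \in A) * 2 ^ c x.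
Proof. by rewrite /code big_mkcond; apply: eq_bigr => x _; case: ifP; rewrite ?mul1n. Qed.

Lemma bit_code A x : bit (code A) (c x) = (x \in A).
Proof. by rewrite /bit codeE (@digit_sum _ _ _ (fun x => x \in A)) // => [|i]; case: (_ \in A). Qed.

Lemma code_lt A : code A < 2 ^ n.
Proof.
rewrite codeE; have := @sum_digits_lt _ _ 2 (fun x => x \in A) c_inj isT.
move=> /(_ (fun i => _) n); under eq_bigl => i do rewrite ltn_ord.
by apply=> i; case: (i \in A).
Qed.

(** Subsets become ordinals, so the coding can be iterated: families of subsets get codes below
    [2 ^ 2 ^ n]. *)
Definition set_ord A : 'I_(2 ^ n) := Ordinal (code_lt A).

Lemma set_ord_bij : bijective set_ord.
Proof.
apply: inj_card_bij => [A B [eAB]|].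
  by apply/setP => x; rewrite -!bit_code eAB.
by rewrite card_ord -cardsT -powersetT card_powerset cardsT (bij_eq_card c_bij) card_ord.
Qed.

Lemma all_ord (P : nat -> bool) : all P (iota 0 n) = [forall x, P (c x)].
Proof.
have [c' cK c'K] := c_bij.
apply/allP/forallP => [P_iota x|Pc i]; first by apply: P_iota; rewrite mem_iota /=.
by rewrite mem_iota => /= lt_in; have := Pc (c' (Ordinal lt_in)); rewrite c'K.
Qed.

Lemma has_ord (P : nat -> bool) : has P (iota 0 n) = [exists x, P (c x)].
Proof.
by rewrite -[has _ _]negbK -all_predC all_ord negb_forall; apply: eq_existsb => x /=; rewrite negbK.
Qed.

End Code.

(** * Bounded arithmetic formulas on codes *)

Definition subset_rel n X Y := all (fun i => bit X i ==> bit Y i) (iota 0 n).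

Definition product_rel n t X Y W :=
  all (fun z => bit W z ==
      has (fun x => has (fun y => [&& bit X x, bit Y y & digit n t (x * n + y) == z])
        (iota 0 n)) (iota 0 n))
    (iota 0 n).

(** The definition of [closed_family] on codes: [2 ^ x] codes a singleton, and a product of sets is
    searched for among all codes rather than computed. *)
Definition closed_rel n t K :=
  [&& all (fun x => bit K (2 ^ x)) (iota 0 n),
      all (fun X => all (fun Y => bit K X && bit K Y ==>
          has (fun W => bit K W && product_rel n t X Y W) (iota 0 (2 ^ n)))
        (iota 0 (2 ^ n))) (iota 0 (2 ^ n))
    & all (fun X => all (fun E => all (fun X' =>
          [&& bit K X, bit K E, bit K X', product_rel n t E E E, product_rel n t E X X,
              product_rel n t X E X & product_rel n t X X' E] ==>
          has (fun Y => [&& bit K Y, subset_rel n E Y &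
              has (fun W => product_rel n t Y X W && subset_rel n W Y) (iota 0 (2 ^ n))])
            (iota 0 (2 ^ n)))
        (iota 0 (2 ^ n))) (iota 0 (2 ^ n))) (iota 0 (2 ^ n))].

Definition covered_rel n t Z :=
  all (fun K => closed_rel n t K ==>
      has (fun X => bit K X && subset_rel n Z X) (iota 0 (2 ^ n)))
    (iota 0 (2 ^ 2 ^ n)).

Definition below_idempotent_rel (f : 3.-tuple nat -> nat) n t Z :=
  has (fun E => [&& f [tuple n; t; E] == 1, product_rel n t E E E & subset_rel n Z E])
    (iota 0 (2 ^ n)).

Ltac computable_step ::= first [apply computable_digit | apply computable_bit].

Lemma computable_subset_rel N X Y : computable N -> computable X -> computable Y ->
  computable (fun s => subset_rel (N s) (X s) (Y s)).
Proof. by rewrite /subset_rel => *; computability. Qed.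

Lemma computable_product_rel N T X Y W : computable N -> computable T ->
  computable X -> computable Y -> computable W ->
  computable (fun s => product_rel (N s) (T s) (X s) (Y s) (W s)).
Proof. by rewrite /product_rel => *; computability. Qed.

Ltac computable_step ::=
  first [apply computable_bit | apply computable_subset_rel | apply computable_product_rel].

Lemma computable_closed_rel N T K : computable N -> computable T -> computable K ->
  computable (fun s => closed_rel (N s) (T s) (K s)).
Proof. by rewrite /closed_rel => *; computability. Qed.

Lemma computable_covered_rel N T Z : computable N -> computable T -> computable Z ->
  computable (fun s => covered_rel (N s) (T s) (Z s)).
Proof.
have := computable_closed_rel; rewrite /covered_rel => cl *.
apply: computable_all; first by computability.
apply: computable_implb; last by computable_shift; computability.
by apply: cl; computable_shift; computability.
Qed.

Lemma computable_below_idempotent_rel f N T Z : recursive f ->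
  computable N -> computable T -> computable Z ->
  computable (fun s => below_idempotent_rel f (N s) (T s) (Z s)).
Proof. by rewrite /below_idempotent_rel => *; computability. Qed.

(** * Decoding multiplication tables *)

Section SetProduct.
Local Open Scope group_scope.
Variable M : finMonoidType.
Implicit Types X Y Z : {set M}.

Definition smul X Y : {set M} := [set x * y | x in X, y in Y].

Lemma smulP X Y z :
  reflect (exists x y, [/\ x \in X, y \in Y & z = x * y]) (z \in smul X Y).
Proof.
apply: (iffP idP) => [/imset2P[x y Xx Yy ->]|[x [y [Xx Yy ->]]]]; first by exists x, y.
exact: imset2_f.
Qed.

Lemma mem_smul X Y x y : x \in X -> y \in Y -> x * y \in smul X Y.
Proof. by move=> Xx Yy; apply/smulP; exists x, y. Qed.

Lemma smulS X X' Y Y' : X \subset X' -> Y \subset Y' -> smul X Y \subset smul X' Y'.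
Proof. exact: imset2S. Qed.

Lemma smulA : associative smul.
Proof.
move=> X Y Z; apply/setP => t; apply/smulP/smulP.
  move=> [x [_ [Xx /smulP[y [z [Yy Zz ->]]] ->]]].
  by exists (x * y), z; rewrite mem_smul ?mulgA.
move=> [_ [z [/smulP[x [y [Xx Yy ->]]] Zz ->]]].
by exists x, (y * z); rewrite mem_smul ?mulgA.
Qed.

Lemma smul1s : left_id [set 1] smul.
Proof.
move=> X; apply/setP => x; apply/smulP/idP => [[_ [y [/set1P-> Xy ->]]]|Xx].
  by rewrite mul1g.
by exists 1, x; rewrite set11 mul1g.
Qed.

Lemma smuls1 : right_id [set 1] smul.
Proof.
move=> X; apply/setP => x; apply/smulP/idP => [[y [_ [Xy /set1P-> ->]]]|Xx].
  by rewrite mulg1.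
by exists x, 1; rewrite set11 mulg1.
Qed.

Definition powerset_monoid : Type := {set M}.
HB.instance Definition _ := Finite.on powerset_monoid.
HB.instance Definition _ := isMonoid.Build powerset_monoid smulA smul1s smuls1.

End SetProduct.

(** The last clause says that [E] is the identity and [X'] the inverse of [X] in a
    cyclic group of sets: the set [Y] then contains all the powers of [X]. This is
    Henckell's closure under [X ^ omega + X ^ (omega + 1) + ...], without powers. *)
Definition closed_family (M : finMonoidType) (K : {set {set M}}) : bool :=
  [&& [forall x, [set x] \in K],
      [forall X, forall Y, (X \in K) && (Y \in K) ==> (smul X Y \in K)]
    & [forall X : {set M}, forall E, forall X',
        [&& X \in K, E \in K, X' \in K, E == smul E E, X == smul E X, X == smul X E
          & E == smul X X'] ==>
        [exists Y, [&& Y \in K, E \subset Y & smul Y X \subset Y]]]].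

Section Reflection.
Variables (M : finMonoidType) (n : nat) (r : M -> 'I_n).
Hypothesis r_bij : bijective r.
Implicit Types X Y Z W : {set M}.
Let t := table_code r.
Let rs := set_ord r_bij.
Let rs_bij : bijective rs := set_ord_bij r_bij.

Let bitE X x : bit (rs X) (r x) = (x \in X). Proof. exact: bit_code. Qed.
Let bitsE (K : {set {set M}}) X : bit (code rs K) (rs X) = (X \in K). Proof. exact: bit_code. Qed.

(** Euclidean division by [n] makes [r x * n + r y] injective in the pair, so [table_code] is a
    genuine base-[n] expansion. *)
Lemma digit_table x y : digit n t (r x * n + r y) = r (x * y)%g.
Proof.
rewrite /t /table_code pair_big /=.
pose e (p : M * M) := r p.1 * n + r p.2.
have n_gt0 : 0 < n by apply: leq_ltn_trans (ltn_ord (r 1%g)).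
have e_inj : injective e.
  move=> [a b] [c d]; rewrite /e /= => eq_e.
  have := congr1 (divn^~ n) eq_e; have := congr1 (modn^~ n) eq_e.
  rewrite !modnMDl !modn_small ?ltn_ord// !divnMDl// !divn_small ?ltn_ord// !addn0.
  by move=> /val_inj/(bij_inj r_bij)-> /val_inj/(bij_inj r_bij)->.
exact: (@digit_sum _ e n (fun p => r (p.1 * p.2)%g) e_inj n_gt0 _ (x, y)).
Qed.

Lemma subset_relE X Y : subset_rel n (rs X) (rs Y) = (X \subset Y).
Proof.
rewrite /subset_rel (all_ord r_bij).
apply/forallP/subsetP => sXY x; first by have := sXY x; rewrite !bitE => /implyP.
by rewrite !bitE; apply/implyP/sXY.
Qed.

Lemma product_relE X Y W : product_rel n t (rs X) (rs Y) (rs W) = (W == smul X Y).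
Proof.
rewrite /product_rel (all_ord r_bij).
have E z : has (fun x => has (fun y => [&& bit (rs X) x, bit (rs Y) y &
    digit n t (x * n + y) == r z]) (iota 0 n)) (iota 0 n) = (z \in smul X Y).
  rewrite (has_ord r_bij); apply/existsP/smulP => -[x].
    rewrite (has_ord r_bij) => /existsP[y]; rewrite !bitE digit_table.
    by case/and3P=> Xx Yy /eqP/val_inj/(bij_inj r_bij) <-; exists x, y.
  case=> y [Xx Yy ->]; exists x; rewrite (has_ord r_bij); apply/existsP; exists y.
  by rewrite !bitE digit_table Xx Yy eqxx.
apply/forallP/eqP => [WXY|-> z]; last by rewrite E bitE.
by apply/setP => z; have := WXY z; rewrite E bitE => /eqP.
Qed.

Lemma closed_relE (K : {set {set M}}) : closed_rel n t (code rs K) = closed_family K.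
Proof.
rewrite /closed_rel /closed_family; congr [&& _, _ & _].
- rewrite (all_ord r_bij); apply: eq_forallb => x.
  by rewrite -(bitsE K) /= /code big_set1.
- rewrite (all_ord rs_bij); apply: eq_forallb => X.
  rewrite (all_ord rs_bij); apply: eq_forallb => Y.
  rewrite !bitsE (has_ord rs_bij); congr (_ ==> _).
  apply/existsP/idP => [[W]|KXY]; first by rewrite bitsE product_relE => /andP[KW /eqP<-].
  by exists (smul X Y); rewrite bitsE product_relE KXY /=.
rewrite (all_ord rs_bij); apply: eq_forallb => X.
rewrite (all_ord rs_bij); apply: eq_forallb => E.
rewrite (all_ord rs_bij); apply: eq_forallb => X'.
rewrite !bitsE !product_relE (has_ord rs_bij); congr (_ ==> _).
apply: eq_existsb => Y; rewrite bitsE subset_relE; congr [&& _, _ & _].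
rewrite (has_ord rs_bij); apply/existsP/idP => [[W]|sYX].
  by rewrite product_relE subset_relE => /andP[/eqP->].
by exists (smul Y X); rewrite product_relE subset_relE eqxx.
Qed.

Lemma covered_relE Z : covered_rel n t (rs Z) =
  [forall K, closed_family K ==> [exists X : {set M}, (X \in K) && (Z \subset X)]].
Proof.
rewrite /covered_rel (all_ord (set_ord_bij rs_bij)); apply: eq_forallb => K.
rewrite closed_relE (has_ord rs_bij); congr (_ ==> _); apply: eq_existsb => X.
by rewrite subset_relE bitsE.
Qed.

Lemma below_idempotent_relE f Z : below_idempotent_rel f n t (rs Z) =
  [exists E : {set M},
    [&& f [tuple n; t; subset_code r E] == 1, E == smul E E & Z \subset E]].
Proof.
rewrite /below_idempotent_rel (has_ord rs_bij); apply: eq_existsb => E.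
by rewrite subset_relE product_relE.
Qed.

End Reflection.

(** The candidates [E] have finitely many codes, and each is tested with the algorithm for [P]. *)
Lemma decidable_below_idempotent (P : forall M : finMonoidType, {set M} -> Prop) :
  decidable_subsets P ->
  decidable_subsets (fun M Z => exists E, [/\ P M E, smul E E = E & Z \subset E]).
Proof.
move=> [f rf fP].
exists (fun v => below_idempotent_rel f (nth 0 v 0) (nth 0 v 1) (nth 0 v 2)).
  exact: (computable_below_idempotent_rel rf (computable_nth 0) (computable_nth 1)
    (computable_nth 2)).
move=> M n r r_bij Z; rewrite /= (below_idempotent_relE r_bij f Z).
split=> [|[E [PE EE ZE]]].
  case: existsP => // -[E /and3P[/eqP fE /eqP EE ZE]] _; exists E; split=> //.
  by apply/(fP _ _ _ r_bij).
case: existsP => // -[]; exists E.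
by rewrite EE eqxx ZE !andbT; apply/eqP/(fP _ _ _ r_bij).
Qed.

Lemma decidable_covered : decidable_subsets (fun M Z => forall K : {set {set M}},
  closed_family K -> exists2 X, X \in K & Z \subset X).
Proof.
exists (fun v => covered_rel (nth 0 v 0) (nth 0 v 1) (nth 0 v 2)).
  exact: (computable_covered_rel (computable_nth 0) (computable_nth 1) (computable_nth 2)).
move=> M n r r_bij Z; rewrite /= (covered_relE r_bij Z).
split=> [|cZ].
  case: forallP => // cZ _ K clK; have /implyP/(_ clK)/existsP[X /andP[]] := cZ K.
  by exists X.
case: forallP => // -[] K; apply/implyP => /cZ[X KX ZX].
by apply/existsP; exists X; rewrite KX.
Qed.

(** * Aperiodic monoids *)

Local Open Scope group_scope.

(** Pigeonhole on the exponents up to [#|M|] gives an index [k] and a period [p]. *)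
Lemma expg_period (M : finMonoidType) (x : M) :
  exists k p, 0 < p /\ forall i m, k <= i -> x ^+ (i + m * p) = x ^+ i.
Proof.
have [k [p [p_gt0 xkp]]] : exists k p, 0 < p /\ x ^+ (k + p) = x ^+ k.
  pose f (i : 'I_#|M|.+1) := x ^+ i.
  have /injectivePn[i [j ij fij]] : ~~ injectiveb f.
    by apply/negP => /injectiveP/leq_card; rewrite card_ord ltnn.
  wlog lt_ij : i j ij fij / i < j.
    move=> wl; case: (ltngtP i j) => [||/val_inj eij]; last by rewrite eij eqxx in ij.
      exact: wl.
    by apply: wl => //; rewrite eq_sym.
  by exists i, (j - i)%N; rewrite subn_gt0 lt_ij subnKC ?(ltnW lt_ij).
exists k, p; split=> // i m /subnK <-; elim: m => [|m IHm]; first by rewrite addn0.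
rewrite -[RHS]IHm (_ : _ + _ = (i - k + m * p) + (k + p))%N; last by lia.
rewrite (_ : (i - k + k + m * p = (i - k + m * p) + k)%N); last by lia.
by rewrite expgnDr xkp -expgnDr.
Qed.

(** The powers of [x] with large exponents form a cyclic group inside [S], hence a single
    element. *)
Lemma aperiodic_expg (M : finMonoidType) (S : {set M}) (x : M) k :
  aperiodic S -> (forall j, k <= j -> x ^+ j \in S) -> exists j, x ^+ j = x ^+ j.+1.
Proof.
move=> aS xS; have [l [p [p_gt0 xp]]] := expg_period x.
pose m := maxn k l; have lem : l <= m by rewrite leq_maxr.
pose G := [set y : M | `[< exists2 j, m <= j & y = x ^+ j >]].
have GE j : m <= j -> x ^+ j \in G by move=> mj; rewrite inE; apply/asboolP; exists j.
have GP y : y \in G -> exists2 j, m <= j & y = x ^+ j by rewrite inE => /asboolP.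
have mp : m <= m * p by rewrite leq_pmulr.
have : #|G| = 1%N.
  apply: aS; first by apply/subsetP => _ /GP[j mj ->]; apply: xS; lia.
  split=> [_ _ /GP[i mi ->] /GP[j mj ->]|]; first by rewrite -expgnDr GE//; lia.
  (* Exponents that are at least [m] and multiples of [p] give the identity; the inverse of [x ^+ j]
     completes [j] to such a multiple. *)
  exists (x ^+ (m * p)); first exact: GE.
  move=> _ /GP[j mj ->]; split; first by rewrite -expgnDr addnC xp//; lia.
  split; first by rewrite -expgnDr xp//; lia.
  have jp : (j * p - j + j = j * p)%N by rewrite subnK// leq_pmulr.
  exists (x ^+ (m * p + (j * p - j))); first by rewrite GE//; lia.
  rewrite -!expgnDr (_ : j + _ = m * p + j * p)%N; last by lia.
  rewrite (_ : _ + _ + j = m * p + j * p)%N; last by lia.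
  by rewrite xp//; lia.
move/eqP/cards1P => [y Gy]; exists m.
have := GE m (leqnn m); have := GE m.+1 (leqnSn m).
by rewrite Gy !inE => /eqP-> /eqP->.
Qed.

(** In a group with identity [u], cancelling [x] from [u * x ^+ k = u * x ^+ k.+1] leaves [u = x];
    the factor [u] covers [k = 0], where [x ^+ 0] is the identity of [M]. *)
Lemma expg_aperiodic (M : finMonoidType) (S : {set M}) :
  (forall x, x \in S -> exists k, x ^+ k = x ^+ k.+1) -> aperiodic S.
Proof.
move=> xS G sGS [_ [u Gu uP]].
suff -> : G = [set u] by rewrite cards1.
apply/setP => x; rewrite inE; apply/idP/eqP => [Gx|->//].
have [uu _] := uP u Gu; have [ux [xu [y Gy [xy _]]]] := uP x Gx.
have uxu k : u * x ^+ k * u = u * x ^+ k.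
  by case: k => [|k]; rewrite ?mulg1 // expgSr -!mulgA xu.
have uxy k : u * x ^+ k.+1 * y = u * x ^+ k by rewrite expgSr -!mulgA xy mulgA uxu.
have [k] := xS x (subsetP sGS _ Gx).
move/(congr1 (fun z => u * z)); elim: k => [|k IHk]; first by rewrite mulg1 ux.
by move/(congr1 (fun z => z * y)); rewrite !uxy => /IHk.
Qed.

Lemma aperiodic_monoidP (M : finMonoidType) :
  aperiodic_monoid M <-> forall x : M, exists k, x ^+ k = x ^+ k.+1.
Proof.
split=> [aM x|xM]; last by apply: expg_aperiodic => x _.
by apply: (@aperiodic_expg _ _ x 0 aM) => j _; rewrite inE.
Qed.

Lemma expg_stable (M : finMonoidType) (x : M) k j :
  x ^+ k = x ^+ k.+1 -> k <= j -> x ^+ j = x ^+ k.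
Proof.
move=> xk /subnK <-; elim: (j - k)%N => // i IHi.
by rewrite addSn expgS IHi -expgS -xk.
Qed.

Lemma monoid_morphismX (M N : finMonoidType) (f : M -> N) k x :
  monoid_morphism f -> f (x ^+ k) = f x ^+ k.
Proof. by move=> [f1 fM]; elim: k => // k IHk; rewrite !expgS fM IHk. Qed.

Lemma aperiodic_pseudovariety : pseudovariety aperiodic_monoid.
Proof.
split.
- move=> M M1; apply/aperiodic_monoidP => x; exists 0%N.
  by apply/(fintype_le1P _) ; rewrite M1.
- move=> M N /aperiodic_monoidP aM /aperiodic_monoidP aN; apply/aperiodic_monoidP => -[x y].
  have [k xk] := aM x; have [l yl] := aN y; exists (maxn k l).
  have E j : ((x, y) : (M * N)%type) ^+ j = (x ^+ j, y ^+ j).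
    by elim: j => // j IHj; rewrite !expgS IHj.
  by rewrite !E !(expg_stable xk) ?(expg_stable yl)//; lia.
- move=> M N f fM f_inj /aperiodic_monoidP aN; apply/aperiodic_monoidP => x.
  have [k xk] := aN (f x); exists k; apply: f_inj.
  by rewrite !(monoid_morphismX _ _ fM).
move=> M N f fM f_surj /aperiodic_monoidP aM; apply/aperiodic_monoidP => y.
have [x <-] := f_surj y; have [k xk] := aM x; exists k.
by rewrite -!(monoid_morphismX _ _ fM) xk.
Qed.

Lemma relational_morphismX (M N : finMonoidType) (phi : M -> {set N}) x n k :
  relational_morphism phi -> n \in phi x -> n ^+ k \in phi (x ^+ k).
Proof.
by move=> [_ phi1 phiM] nx; elim: k => // k IHk; rewrite !expgS; apply: phiM.
Qed.

Lemma relational_morphism_set1 (M : finMonoidType) :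
  relational_morphism (fun m : M => [set m]).
Proof.
split=> [m||m m' n n']; rewrite ?set11//; first by apply/set0Pn; exists m; rewrite inE.
by move=> /set1P-> /set1P->; rewrite inE.
Qed.

(** For the converse, an [n] related to [x] has an idempotent power [n ^+ k], and all high powers of
    [x] lie in its preimage, which is aperiodic. *)
Lemma aperiodic_malcev_fixed (M : finMonoidType) :
  aperiodic_monoid M <-> aperiodic_malcev aperiodic_monoid M.
Proof.
split=> [aM|[N [phi [/aperiodic_monoidP aN rphi aphi]]]].
  exists M, (fun m => [set m]); split=> //; first exact: relational_morphism_set1.
  by move=> e _; apply: expg_aperiodic => x _; move/aperiodic_monoidP: aM.
apply/aperiodic_monoidP => x.
have [phi0 _ _] := rphi; have /set0Pn[n xn] := phi0 x; have [k nk] := aN n.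
have nn : Defs.idempotent (n ^+ k) by rewrite /Defs.idempotent -expgnDr (expg_stable nk)//; lia.
apply: (aperiodic_expg (k := k) (aphi _ nn)) => j kj.
by rewrite inE -(expg_stable nk kj); apply: relational_morphismX.
Qed.

(** * Local divisors and aperiodic covers *)

HB.instance Definition _ := isMonoid.Build unit (mul := fun _ _ => tt) (one := tt)
  (fun _ _ _ => erefl) (fun x => match x with tt => erefl end)
  (fun x => match x with tt => erefl end).

Lemma aperiodic_unit : aperiodic_monoid unit.
Proof. by apply/aperiodic_monoidP => -[]; exists 0%N. Qed.

Section LocalDivisor.
Variables (C : finMonoidType) (a : C).

(** The elements [a] and [a * c * a] form a submonoid of the usual local divisor, the intersection
    of [a C] and [C a]; the second form serves to bound powers below. *)
Definition in_local_divisor : pred C := fun x => (x == a) || [exists c, x == a * c * a].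
Definition local_divisor : Type := {x : C | in_local_divisor x}.
HB.instance Definition _ := Finite.on local_divisor.
Implicit Types x y z : local_divisor.

Definition left_factor (x : C) : C := odflt 1 [pick u | u * a == x].

Lemma left_factorK x : left_factor (sval x) * a = sval x.
Proof.
rewrite /left_factor; case: pickP => [u /eqP //|noF]; case: x noF => x /= /orP[/eqP->|].
  by move/(_ 1); rewrite mul1g eqxx.
by case/existsP => c /eqP-> /(_ (a * c)); rewrite eqxx.
Qed.

Lemma right_factor x : exists v, sval x = a * v.
Proof.
case: x => x /= /orP[/eqP->|/existsP[c /eqP->]]; first by exists 1; rewrite mulg1.
by exists (c * a); rewrite mulgA.
Qed.

Lemma local_mul_subproof x y : in_local_divisor (left_factor (sval x) * sval y).
Proof.
apply/orP; have := left_factorK x; move: (left_factor _) => u.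
case: y => y /= /orP[/eqP->|/existsP[d /eqP->]].
  by move->; case: x => x /= /orP.
rewrite !mulgA => ->; right; apply/existsP.
case: x => x /= /orP[/eqP->|/existsP[c /eqP->]]; first by exists d.
by exists (c * a * d); rewrite !mulgA.
Qed.

(** [(u * a) o (a * v) = u * a * v], which does not depend on the choice of [u]. *)
Definition local_mul x y : local_divisor :=
  exist (fun u => in_local_divisor u) _ (local_mul_subproof x y).
Definition local_one : local_divisor :=
  exist (fun u => in_local_divisor u) a (introT orP (or_introl (eqxx a))).

(** Since [y] begins with [a], the product of [u] and [y] depends on [u * a] only. *)
Lemma local_mulE x y u : u * a = sval x -> sval (local_mul x y) = u * sval y.
Proof.
by move=> ua; have [v yv] := right_factor y; rewrite /= yv !mulgA left_factorK ua.
Qed.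

Lemma local_mulA : associative local_mul.
Proof.
move=> x y z; apply: val_inj; symmetry.
pose u := left_factor (sval x) * left_factor (sval y).
apply: etrans (local_mulE (x := local_mul x y) z (u := u) _) _.
  by rewrite -mulgA left_factorK.
by rewrite /= mulgA.
Qed.

Lemma local_mul1 : left_id local_one local_mul.
Proof. by move=> x; apply: val_inj; apply: etrans (local_mulE (u := 1) _ _) _; rewrite mul1g. Qed.

Lemma local_mulr1 : right_id local_one local_mul.
Proof. by move=> x; apply: val_inj; rewrite /= left_factorK. Qed.

HB.instance Definition _ := isMonoid.Build local_divisor local_mulA local_mul1 local_mulr1.

(** The identity [1] is missing: [1 = a] or [1 = a * c * a] would give [a] a right inverse. This
    strict decrease drives the induction of [aperiodic_cover]. *)
Lemma card_local_divisor : (forall c, a * c != 1) -> #|{: local_divisor}| < #|C|.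
Proof.
move=> a_nunit; rewrite card_sig; apply: (@proper_card _ (mem in_local_divisor) (mem C)).
rewrite properE; apply/andP; split; first exact/subsetP.
apply/subsetPn; exists 1 => //; apply/negP => /orP[/eqP a1|/existsP[c]].
  by have := a_nunit 1; rewrite mulg1 -a1 eqxx.
by rewrite eq_sym -mulgA (negPf (a_nunit _)).
Qed.

Lemma local_divisorX x c k : sval x = a * c * a -> sval (x ^+ k) = a * (c * a) ^+ k.
Proof.
move=> xc; elim: k => [|k IHk]; first by rewrite mulg1.
rewrite !expgS; apply: etrans (local_mulE (u := a * c) _ _) _; first by rewrite xc.
by rewrite IHk !mulgA.
Qed.
End LocalDivisor.

(** What the covering argument uses of inclusion on a closed family, stated abstractly because local
    divisors inherit it. *)
Record bounding_order (C : finMonoidType) (le : C -> C -> Prop) : Prop := {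
  bo_refl : forall x, le x x;
  bo_trans : forall x y z, le x y -> le y z -> le x z;
  bo_mul : forall x x' y y', le x x' -> le y y' -> le (x * y) (x' * y');
  bo_bound : forall x, exists y k, forall i, k <= i -> le (x ^+ i) y
}.

Lemma bounding_order_local_divisor (C : finMonoidType) (le : C -> C -> Prop) (a : C) :
  bounding_order le -> bounding_order (fun x y : local_divisor a => le (sval x) (sval y)).
Proof.
move=> [le_refl le_trans le_mul le_bound]; split=> [//|x y z|x x' y y' xx' yy'|x].
- exact: le_trans.
- apply: (@le_trans _ (left_factor a (sval x) * sval y')).
    exact: le_mul.
  have [v yv] := right_factor y'.
  by rewrite [sval (x' * y')]/= yv !mulgA !left_factorK; apply: le_mul.
have /orP[/eqP xa|/existsP[c /eqP xc]] := svalP x.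
  have x1 : x = 1 by apply: val_inj.
  by exists x, 0%N => i _; rewrite x1 expg1n.
have [y [k yP]] := le_bound (c * a).
(* From [x ^+ i.+1 = a * (c * a) ^+ i * (c * a)] the bound is [a * y * c * a], which has the form
   required of an element of the local divisor. *)
have ayca : in_local_divisor a (a * (y * c) * a) by apply/orP; right; apply/existsP; exists (y * c).
exists (exist (fun x => in_local_divisor a x) _ ayca), k.+1 => -[//|i] ki.
rewrite (local_divisorX _ xc) expgSr /=.
by rewrite !mulgA; do 3!apply: (le_mul) => //; exact: yP.
Qed.

(** A Rees matrix semigroup over [N] with sandwich matrix [g (q * p)], with [P] added on top and
    acting on the two outer coordinates. *)
Definition rees_extension (P N : finMonoidType) (g : P -> N) : Type := (P + P * N * P)%type.

Section ReesExtension.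
Variables (P N : finMonoidType) (g : P -> N).

HB.instance Definition _ := Finite.on (rees_extension g).

Definition rees_mul (s t : rees_extension g) : rees_extension g :=
  match s, t with
  | inl p, inl p' => inl (p * p')
  | inl p, inr (p', x, q) => inr (p * p', x, q)
  | inr (p, x, q), inl q' => inr (p, x, q * q')
  | inr (p, x, q), inr (p', x', q') => inr (p, x * g (q * p') * x', q')
  end.

Lemma rees_mulA : associative rees_mul.
Proof. by move=> [p|[[p x] q]] [p'|[[p' x'] q']] [p''|[[p'' x''] q'']]; rewrite /= ?mulgA. Qed.

Lemma rees_mul1 : left_id (inl 1 : rees_extension g) rees_mul.
Proof. by move=> [p|[[p x] q]]; rewrite /= mul1g. Qed.

Lemma rees_mulr1 : right_id (inl 1 : rees_extension g) rees_mul.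
Proof. by move=> [p|[[p x] q]]; rewrite /= mulg1. Qed.

HB.instance Definition _ := isMonoid.Build (rees_extension g) rees_mulA rees_mul1 rees_mulr1.

Lemma rees_mulE (s t : rees_extension g) : s * t = rees_mul s t.
Proof. by []. Qed.

(** A power of [inr (p, x, q)] has middle entry [(x * g (q * p)) ^+ i * x], with [i] one less than
    the exponent, and so stabilizes one step after the power in [N]. *)
Lemma aperiodic_rees_extension :
  aperiodic_monoid P -> aperiodic_monoid N -> aperiodic_monoid (rees_extension g).
Proof.
move=> /aperiodic_monoidP aP /aperiodic_monoidP aN; apply/aperiodic_monoidP => -[p|[[p x] q]].
  have [k pk] := aP p; exists k.
  have E i : (inl p : rees_extension g) ^+ i = inl (p ^+ i).
    by elim: i => // i IHi; rewrite !expgS IHi.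
  by rewrite !E pk.
have [k xk] := aN (x * g (q * p)); exists k.+1.
have E i : (inr (p, x, q) : rees_extension g) ^+ i.+1 = inr (p, (x * g (q * p)) ^+ i * x, q).
  elim: i => [|i IHi]; first by rewrite expg1 mul1g.
  by rewrite expgS IHi rees_mulE /= [in RHS]expgS !mulgA.
by rewrite !E xk.
Qed.

End ReesExtension.

(** * Bounding words through aperiodic monoids *)

Section Cover.
Variables (C : finMonoidType) (le : C -> C -> Prop).
Hypothesis le_bo : bounding_order le.
Let le_refl := bo_refl le_bo.
Let le_trans := bo_trans le_bo.
Let le_mul := bo_mul le_bo.

(** Each right-invertible [c] has some [c ^+ p = 1], so a bound of its high powers is above both [1]
    and [c]; the product of these bounds over [U] is above every element of [U], and [U] contains
    the value of every word over [A]. *)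
Lemma invertible_bound (A : {set C}) :
  (forall c, c \in A -> exists c', c * c' = 1) ->
  exists y, forall w : seq C, {subset w <= A} -> le (\prod_(c <- w) c) y.
Proof.
move=> A_inv.
pose U := [set c : C | [exists c', c * c' == 1]].
have UP c : reflect (exists c', c * c' = 1) (c \in U).
  by rewrite inE; apply: (iffP existsP) => -[c' /eqP]; exists c'.
have /fin_all_exists[y yP] (c : C) : exists y, c \in U -> le 1 y /\ le c y.
  have [/UP[c' cc']|] := boolP (c \in U); last by exists 1.
  have [y [k yk]] := bo_bound le_bo c.
  have [l [p [p_gt0 cp]]] := expg_period c.
  have ccX i : c ^+ i * c' ^+ i = 1.
    by elim: i => [|i IHi]; rewrite ?mulg1 // expgSr expgS mulgA -(mulgA _ c) cc' mulg1.
  have cp1 : c ^+ p = 1.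
    have := cp l 1%N (leqnn l); rewrite mul1n addnC expgnDr => /(congr1 (fun z => z * c' ^+ l)).
    by rewrite /= -mulgA ccX mulg1.
  exists y => _; split.
    by rewrite -(expg1n _ k) -cp1 -expgnA; apply: yk; rewrite leq_pmull.
  rewrite -[c in le c]mulg1 -(expg1n _ k) -cp1 -expgnA -expgS.
  by apply: yk; rewrite ltnW // ltnS leq_pmull.
have U_prod w : {subset w <= A} -> \prod_(c <- w) c \in U.
  elim: w => [_|c w IHw sA]; first by rewrite big_nil; apply/UP; exists 1; rewrite mulg1.
  have /UP[d wd] : \prod_(c <- w) c \in U by apply: IHw => d dw; apply: sA; rewrite inE dw orbT.
  have [c' cc'] := A_inv c (sA c (mem_head _ _)).
  by apply/UP; exists (d * c'); rewrite big_cons -mulgA (mulgA _ d) wd mul1g.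
exists (\prod_(c <- enum U) y c) => w /U_prod; move: (\prod_(c <- w) c) => c {w} Uc.
have : {subset enum U <= U} by move=> d; rewrite mem_enum.
have : c \in enum U by rewrite mem_enum.
elim: (enum U) => // d s IHs cs sU.
have [le1 led] := yP _ (sU d (mem_head _ _)).
have sU' : {subset s <= U} by move=> b bs; apply: sU; rewrite inE bs orbT.
rewrite big_cons; move: cs; rewrite inE => /orP[/eqP->|cs].
  rewrite -[X in le X]mulg1; apply: le_mul => //.
  elim: s sU' {IHs sU} => [_|b s IHs sU]; first by rewrite big_nil.
  rewrite big_cons -[X in le X]mulg1; apply: le_mul.
    by case: (yP _ (sU b (mem_head _ _))).
  by apply: IHs => b' bs; apply: sU; rewrite inE bs orbT.
by rewrite -[X in le X]mul1g; apply: le_mul => //; exact: IHs.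
Qed.

(** A word with at least one [a] reads [w0 a w1 a ... a wk] with the [wi] free of [a].
    The extension remembers the values of [w0] and [wk] in [N0], and the value in [N1]
    of the sequence of the blocks [a wi a], where [wi] is replaced by its bound [X0]. *)
Lemma letter_cover (A : {set C}) (a : C)
  (N0 : finMonoidType) (b0 : C -> N0) (X0 : N0 -> C)
  (N1 : finMonoidType) (b1 : local_divisor a -> N1) (X1 : N1 -> local_divisor a) :
  aperiodic_monoid N0 -> aperiodic_monoid N1 ->
  (forall w : seq C, {subset w <= A :\ a} -> le (\prod_(c <- w) c) (X0 (\prod_(c <- w) b0 c))) ->
  (forall v : seq (local_divisor a),
    le (sval (\prod_(c <- v) c : local_divisor a)) (sval (X1 (\prod_(c <- v) b1 c)))) ->
  exists (N : finMonoidType) (b : C -> N) (X : N -> C), aperiodic_monoid N /\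
    forall w : seq C, {subset w <= A} -> le (\prod_(c <- w) c) (X (\prod_(c <- w) b c)).
Proof.
move=> aN0 aN1 X0P X1P.
have blkP n : in_local_divisor a (a * X0 n * a) by apply/orP; right; apply/existsP; exists (X0 n).
pose blk n : local_divisor a := exist (fun u => in_local_divisor a u) _ (blkP n).
pose N : finMonoidType := rees_extension (b1 \o blk).
(* Between two consecutive letters [a], the value [n] of the block in [N0] enters the middle
   coordinate as [b1 (blk n)]. *)
pose b c : N := if c == a then inr (1, 1, 1) else inl (b0 c).
pose X (n : N) := match n with
  | inl p => X0 p
  | inr (p, x, q) => X0 p * sval (X1 x) * X0 q end.
exists N, b, X; split; first exact: aperiodic_rees_extension.
have split_word w : {subset w <= A} ->
    ({subset w <= A :\ a} /\ \prod_(c <- w) b c = inl (\prod_(c <- w) b0 c)) \/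
    exists (w0 : seq C) (v : seq (local_divisor a)) q, [/\ {subset w0 <= A :\ a},
      \prod_(c <- w) b c = inr (\prod_(c <- w0) b0 c, \prod_(c <- v) b1 c, q)
      & le (\prod_(c <- w) c)
          ((\prod_(c <- w0) c) * sval (\prod_(c <- v) c : local_divisor a) * X0 q)].
  elim: w => [_|c w IHw sA]; first by left; rewrite !big_nil.
  have Ac : c \in A := sA c (mem_head _ _).
  have {}IHw := IHw (fun d dw => sA d (@mem_behead _ (c :: w) d dw)).
  have [eca|nca] := eqVneq c a.
    right; have bc : b c = inr (1, 1, 1) by rewrite /b eca eqxx.
    case: IHw => [[wA bw]|[w0 [v [q [w0A bw le_w]]]]].
      exists [::], [::], (\prod_(c <- w) b0 c); split=> //.
        by rewrite big_cons bc bw !big_nil rees_mulE /= mul1g.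
      by rewrite big_cons !big_nil eca mul1g; apply: le_mul => //; exact: X0P.
    (* The former prefix [w0] now lies between two letters [a], so it becomes the first block of the
       sequence. *)
    exists [::], (blk (\prod_(c <- w0) b0 c) :: v), q; split=> //.
      by rewrite !big_cons bc bw big_nil rees_mulE /= !mul1g.
    rewrite !big_cons big_nil mul1g eca.
    apply: (le_trans (le_mul (le_refl a) le_w)); rewrite !mulgA; apply: le_mul => //.
    (* The product in the local divisor merges the last [a] of the new block with the first [a] of
       [V]. *)
    set V := \prod_(_ <- v) _.
    have -> : sval (blk (\prod_(c <- w0) b0 c) * V) = a * X0 (\prod_(c <- w0) b0 c) * sval V.
      exact: local_mulE.
    by apply: le_mul => //; apply: le_mul => //; exact: X0P.
  have bc : b c = inl (b0 c) by rewrite /b (negPf nca).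
  have cA : c \in A :\ a by rewrite !inE nca.
  have consA (s : seq C) : {subset s <= A :\ a} -> {subset c :: s <= A :\ a}.
    by move=> sA' d; rewrite inE => /orP[/eqP->|/sA'].
  case: IHw => [[wA bw]|[w0 [v [q [w0A bw le_w]]]]].
    by left; split; [exact: consA|rewrite !big_cons bc bw].
  right; exists (c :: w0), v, q; split; first exact: consA.
    by rewrite !big_cons bc bw.
  by rewrite !big_cons -!mulgA; apply: le_mul => //; rewrite mulgA.
move=> w /split_word[[wA ->]|[w0 [v [q [w0A -> le_w]]]]]; first exact: X0P.
by apply: (le_trans le_w); apply: (le_mul) => //; apply: le_mul; [exact: X0P|exact: X1P].
Qed.

End Cover.

(** Induction on [#|C|], then on [#|A|]. Removing a letter [a] without right inverse gives a smaller
    alphabet, and the local divisor at [a] is a smaller monoid, taken with its full alphabet. When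
    every letter is invertible, a constant bound suffices. *)
Theorem aperiodic_cover (C : finMonoidType) (le : C -> C -> Prop) (A : {set C}) :
  bounding_order le ->
  exists (N : finMonoidType) (b : C -> N) (X : N -> C), aperiodic_monoid N /\
    forall w : seq C, {subset w <= A} -> le (\prod_(c <- w) c) (X (\prod_(c <- w) b c)).
Proof.
move: {2}#|C|.+1 (ltnSn #|C|) => m.
elim: m C le A => // m IHm C le A; rewrite ltnS => leCm le_bo.
move: {2}#|A|.+1 (ltnSn #|A|) => k; elim: k A => // k IHk A; rewrite ltnS => leAk.
have [/existsP[a /andP[Aa /forallP aN1]]|/existsPn A_inv] :=
    boolP [exists a : C, (a \in A) && [forall c, a * c != 1]].
  have [|N0 [b0 [X0 [aN0 X0P]]]] := IHk (A :\ a).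
    by move: leAk; rewrite (cardsD1 a) Aa.
  have := bounding_order_local_divisor a le_bo.
  move=> /(IHm (local_divisor a) _ [set: local_divisor a]).
  case=> [|N1 [b1 [X1 [aN X1P]]]].
    by apply: leq_trans leCm; exact: card_local_divisor.
  apply: (letter_cover le_bo aN0 aN X0P) => v; apply: X1P => c _; exact: in_setT.
have [c Ac|y yP] := invertible_bound le_bo (A := A).
  by have := A_inv c; rewrite Ac negb_forall /= => /existsP[c']; rewrite negbK => /eqP; exists c'.
exists unit, (fun=> tt), (fun=> y); split; first exact: aperiodic_unit.
by move=> w /yP.
Qed.

(** * Aperiodic pointlike sets *)

Lemma closed_familyP (M : finMonoidType) (K : {set {set M}}) :
  reflect [/\ forall x, [set x] \in K,
              forall X Y, X \in K -> Y \in K -> smul X Y \in K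
            & forall X E X', X \in K -> E \in K -> X' \in K ->
                E = smul E E -> X = smul E X -> X = smul X E -> E = smul X X' ->
                exists Y, [/\ Y \in K, E \subset Y & smul Y X \subset Y]]
          (closed_family K).
Proof.
apply: (iffP and3P) => -[K1 KM KG]; split.
- exact/forallP.
- by move=> X Y KX KY; have /implyP := forallP (forallP KM X) Y; rewrite KX KY; exact.
- move=> X E X' KX KE KX' EE EX XE EXX'.
  have /implyP := forallP (forallP (forallP KG X) E) X'.
  rewrite KX KE KX' -EE -EX -XE -EXX' !eqxx => /(_ isT)/existsP[Y /and3P[KY EY YX]].
  by exists Y.
- exact/forallP.
- by apply/forallP => X; apply/forallP => Y; apply/implyP => /andP[]; exact: KM.
apply/forallP => X; apply/forallP => E; apply/forallP => X'; apply/implyP.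
case/and5P=> KX KE KX' /eqP EE /and3P[/eqP EX /eqP XE /eqP EXX'].
by have [Y [KY EY YX]] := KG X E X' KX KE KX' EE EX XE EXX'; apply/existsP; exists Y; apply/and3P.
Qed.

(** Recovers powers from the power-free form of [closed_family]: multiplying [x ^+ (p + k) = x ^+ k]
    by [e] on the left and by [x' ^+ k] on the right leaves [x ^+ p = e]. *)
Lemma unit_expg (M : finMonoidType) (x e x' : M) :
  e = e * e -> x = e * x -> x = x * e -> e = x * x' -> exists2 p, 0 < p & x ^+ p = e.
Proof.
move=> ee ex xe exx'; have [k [p [p_gt0 xp]]] := expg_period x.
have exe i : e * x ^+ i * e = e * x ^+ i.
  by case: i => [|i]; rewrite ?mulg1 -?ee // expgSr -!mulgA -xe.
have exx i : e * x ^+ i * x' ^+ i = e.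
  elim: i => [|i IHi]; first by rewrite !mulg1.
  by rewrite expgSr expgS !mulgA -(mulgA _ x) -exx' exe.
exists p => //; case: p p_gt0 xp => // p _ xp.
have expp : e * x ^+ p.+1 = x ^+ p.+1 by rewrite expgS mulgA -ex.
have expe : x ^+ p.+1 = x ^+ p.+1 * e by rewrite expgSr -mulgA -xe.
have := xp k 1%N (leqnn k); rewrite mul1n addnC expgnDr => /(congr1 (fun z => e * z * x' ^+ k)).
by rewrite exx mulgA expp {1}expe -!mulgA (mulgA e) exx -expe.
Qed.

Lemma rel_preimX (M N : finMonoidType) (phi : M -> {set N}) (X : powerset_monoid M) n k :
  relational_morphism phi -> (X : {set M}) \subset rel_preim phi n ->
  (X ^+ k : {set M}) \subset rel_preim phi (n ^+ k).
Proof.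
move=> [_ phi1 phiM] Xn; elim: k => [|k IHk].
  by apply/subsetP => _ /set1P->; rewrite inE.
rewrite !expgS; apply/subsetP => _ /smulP[x [y [Xx Xy ->]]].
by rewrite inE; apply: phiM; [have := subsetP Xn _ Xx | have := subsetP IHk _ Xy]; rewrite inE.
Qed.

(** The cyclic group of [X] is bounded by the union of the sets [e * x ^+ i]. Each of these equals a
    power of [X] of arbitrarily high exponent, so if [X] lies over [n], they all lie over the stable
    power of [n]. *)
Lemma closed_family_pointlike (M : finMonoidType) :
  closed_family [set X : {set M} | `[< pointlike aperiodic_monoid X >]].
Proof.
apply/closed_familyP; split.
- move=> x; rewrite inE; apply/asboolP => N phi _ [phi0 _ _].
  by have /set0Pn[n xn] := phi0 x; exists n; rewrite sub1set inE.
- move=> X Y; rewrite !inE => /asboolP plX /asboolP plY; apply/asboolP => N phi aN rphi.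
  have [n Xn] := plX N phi aN rphi; have [n' Yn'] := plY N phi aN rphi.
  have [_ _ phiM] := rphi.
  exists (n * n'); apply/subsetP => _ /smulP[x [y [Xx Yy ->]]].
  rewrite inE; apply: phiM; [have := subsetP Xn _ Xx | have := subsetP Yn' _ Yy]; by rewrite inE.
move=> X E X'; rewrite !inE => /asboolP plX _ _ EE EX XE EXX'.
pose x : powerset_monoid M := X; pose e : powerset_monoid M := E.
have [p p_gt0 xp] := @unit_expg (powerset_monoid M) x e X' EE EX XE EXX'.
exists [set m : M | `[< exists i, m \in (e * x ^+ i : {set M}) >]]; split.
- rewrite inE; apply/asboolP => N phi aN rphi.
  have [n Xn] := plX N phi aN rphi; have [k nk] := (aperiodic_monoidP N).1 aN n.
  exists (n ^+ k); apply/subsetP => m; rewrite inE => /asboolP[i].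
  have ek : e ^+ k.+1 = e by elim: k {nk} => // k IHk; rewrite expgS IHk; exact: esym EE.
  rewrite -ek -xp -expgnA -expgnDr => m_xj.
  have kj : k <= p * k.+1 + i by nia.
  by rewrite -(expg_stable nk kj); apply: subsetP m_xj; exact: rel_preimX.
- by apply/subsetP => m Em; rewrite inE; apply/asboolP; exists 0%N; rewrite expg0 mulg1.
apply/subsetP => _ /smulP[m [y [+ Xy ->]]]; rewrite !inE => /asboolP[i m_xi].
by apply/asboolP; exists i.+1; rewrite expgSr mulgA; apply: mem_smul.
Qed.

(** * Closed families as ordered monoids *)

Section ClosedFamily.
Variable M : finMonoidType.

Definition family_monoid (K : {K : {set {set M}} | closed_family K}) : Type :=
  {X : {set M} | X \in sval K}.

Variable K : {K : {set {set M}} | closed_family K}.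
Local Notation C := (family_monoid K).
HB.instance Definition _ := Finite.on C.

Lemma family_mul_subproof (X Y : C) : smul (sval X) (sval Y) \in sval K.
Proof. by have /closed_familyP[_ KM _] := svalP K; exact: KM (svalP X) (svalP Y). Qed.
Definition family_mul (X Y : C) : C := exist (fun Z => Z \in sval K) _ (family_mul_subproof X Y).

Lemma family_set1 x : [set x] \in sval K.
Proof. by have /closed_familyP[] := svalP K. Qed.
Definition singleton (x : M) : C := exist (fun Z => Z \in sval K) _ (family_set1 x).

Lemma family_mulA : associative family_mul.
Proof. by move=> X Y Z; apply: val_inj; rewrite /= smulA. Qed.
Lemma family_mul1 : left_id (singleton 1) family_mul.
Proof. by move=> X; apply: val_inj; rewrite /= smul1s. Qed.
Lemma family_mulr1 : right_id (singleton 1) family_mul.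
Proof. by move=> X; apply: val_inj; rewrite /= smuls1. Qed.
HB.instance Definition _ := isMonoid.Build C family_mulA family_mul1 family_mulr1.

Lemma family_bounding_order : bounding_order (fun X Y : C => sval X \subset sval Y).
Proof.
split=> [X|X Y Z|X X' Y Y'|X]; [exact: subxx|exact: subset_trans|exact: smulS|].
have [k [p [p_gt0 Xp]]] := expg_period X.
have /closed_familyP[_ _ KG] := svalP K.
have kp : k <= k * p by rewrite leq_pmulr.
have Xkp i j m : k <= i -> j = (i + m * p)%N -> X ^+ i = X ^+ j by move=> ki ->; rewrite Xp.
(* The cyclic group of the high powers of [X]: its identity [E], a generator [X1] and the inverse
   [X'] of [X1]. Closure gives [Y] above [E] and stable under [X1], hence above every
   [X ^+ (k * p + j)]. *)
pose E := X ^+ (k * p); pose X1 := X ^+ (k * p + 1); pose X' := X ^+ (k * p + p.-1).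
have EE : E = E * E by rewrite -expgnDr; apply: (Xkp _ _ k); lia.
have EX : X1 = E * X1 by rewrite -expgnDr; apply: (Xkp _ _ k); lia.
have XE : X1 = X1 * E by rewrite -expgnDr; apply: (Xkp _ _ k); lia.
have XX' : E = X1 * X' by rewrite -expgnDr; apply: (Xkp _ _ k.+1); nia.
have [Y [KY EY YX]] := KG _ _ _ (svalP X1) (svalP E) (svalP X') (congr1 sval EE)
  (congr1 sval EX) (congr1 sval XE) (congr1 sval XX').
exists (exist (fun Z => Z \in sval K) Y KY), (k * p)%N => i /subnKC <- /=.
elim: (i - _)%N => [|j IHj]; first by rewrite addn0.
apply: subset_trans YX.
have -> : X ^+ (k * p + j.+1) = X ^+ (k * p + j) * X1.
  by rewrite -expgnDr; apply: (Xkp _ _ k); lia.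
exact: smulS.
Qed.

(** Each [m] is related to the values in [N] of the words over [M] with product [m]. A set over one
    [n] is then contained in [X n], because a product of letters belongs to the product of their
    singletons. *)
Lemma closed_family_cover (Z : {set M}) :
  pointlike aperiodic_monoid Z -> exists2 X, X \in sval K & Z \subset X.
Proof.
move=> plZ.
have [N [b [X [aN XP]]]] := aperiodic_cover [set: C] family_bounding_order.
pose P (m : M) (n : N) :=
  exists2 w : seq M, \prod_(x <- w) x = m & \prod_(x <- w) b (singleton x) = n.
pose phi m := [set n | `[< P m n >]].
have rphi : relational_morphism phi.
  split=> [m||m m' n n'].
  - apply/set0Pn; exists (b (singleton m)); rewrite inE; apply/asboolP.
    by exists [:: m]; rewrite big_seq1.
  - by rewrite inE; apply/asboolP; exists [::]; rewrite big_nil.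
  rewrite !inE => /asboolP[w <- <-] /asboolP[w' <- <-]; apply/asboolP.
  by exists (w ++ w'); rewrite big_cat.
have [n Zn] := plZ N phi aN rphi.
exists (sval (X n)); first exact: (svalP (X n)).
apply/subsetP => z /(subsetP Zn); rewrite inE => /[1!inE] /asboolP[w <- <-].
have := XP (map singleton w) (fun c _ => in_setT c); rewrite !big_map => /subsetP; apply.
elim: w => [|x w IHw]; first by rewrite !big_nil inE.
by rewrite !big_cons; exact: mem_smul (set11 x) IHw.
Qed.
End ClosedFamily.

(** The converse applies the criterion to the closed family of all pointlike sets. *)
Theorem aperiodic_pointlikeP (M : finMonoidType) (Z : {set M}) :
  pointlike aperiodic_monoid Z <->
  forall K : {set {set M}}, closed_family K -> exists2 X, X \in K & Z \subset X.
Proof.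
split=> [plZ K clK|]; first exact: (closed_family_cover (exist (fun K => closed_family K) K clK)).
move=> /(_ _ (closed_family_pointlike M))[X]; rewrite inE => /asboolP plX ZX N phi aN rphi.
by have [n Xn] := plX N phi aN rphi; exists n; apply: subset_trans Xn.
Qed.

Lemma decidable_aperiodic_pointlike : decidable_subsets (pointlike aperiodic_monoid).
Proof.
have [f rf fP] := decidable_covered; exists f => // M n r r_bij Z.
by rewrite fP//; split=> /aperiodic_pointlikeP.
Qed.

(** * Idempotent pointlike sets *)

Section SplitMonoid.
Variable N : finMonoidType.
Implicit Types (n : N) (T : {set N * N}).

(** The two actions of [N]: a longer word extends the second factor on the right or the first factor
    on the left. *)
Definition split_mulr T n : {set N * N} := [set (p.1, p.2 * n) | p in T].
Definition split_mull n T : {set N * N} := [set (n * p.1, p.2) | p in T].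

Lemma split_mulrU T T' n : split_mulr (T :|: T') n = split_mulr T n :|: split_mulr T' n.
Proof. exact: imsetU. Qed.

Lemma split_mullU T T' n : split_mull n (T :|: T') = split_mull n T :|: split_mull n T'.
Proof. exact: imsetU. Qed.

Lemma split_mulrA T n m : split_mulr (split_mulr T n) m = split_mulr T (n * m).
Proof.
rewrite /split_mulr -imset_comp.
by apply: eq_imset => p /=; rewrite mulgA.
Qed.

Lemma split_mullA T n m : split_mull n (split_mull m T) = split_mull (n * m) T.
Proof.
rewrite /split_mull -imset_comp.
by apply: eq_imset => p /=; rewrite mulgA.
Qed.

Lemma split_mullr T n m : split_mull n (split_mulr T m) = split_mulr (split_mull n T) m.
Proof. by rewrite /split_mull /split_mulr -!imset_comp. Qed.

Lemma split_mulr1 T : split_mulr T 1 = T.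
Proof. by rewrite -[RHS]imset_id; apply: eq_imset => -[a b] /=; rewrite mulg1. Qed.

Lemma split_mull1 T : split_mull 1 T = T.
Proof. by rewrite -[RHS]imset_id; apply: eq_imset => -[a b] /=; rewrite mul1g. Qed.

(** A pair [(n, T)] stands for a word of value [n], with [T] the set of pairs of
    values of the two factors of its factorizations. *)
Definition split_monoid : Type := (N * {set N * N})%type.
HB.instance Definition _ := Finite.on split_monoid.

Definition split_mul (s t : split_monoid) : split_monoid :=
  (s.1 * t.1, split_mulr s.2 t.1 :|: split_mull s.1 t.2).

Lemma split_mulA : associative split_mul.
Proof.
move=> [n T] [n' T'] [n'' T'']; rewrite /split_mul /=; congr pair; first exact: mulgA.
by rewrite split_mulrU split_mullU split_mulrA split_mullA split_mullr setUA.
Qed.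

Lemma split_mul1s : left_id ((1, set0) : split_monoid) split_mul.
Proof.
by move=> [n T]; rewrite /split_mul /= mul1g /split_mulr imset0 set0U split_mull1.
Qed.

Lemma split_muls1 : right_id ((1, set0) : split_monoid) split_mul.
Proof.
by move=> [n T]; rewrite /split_mul /= mulg1 /split_mull imset0 setU0 split_mulr1.
Qed.

HB.instance Definition _ := isMonoid.Build split_monoid split_mulA split_mul1s split_muls1.

Lemma split_mulE (s t : split_monoid) :
  s * t = (s.1 * t.1, split_mulr s.2 t.1 :|: split_mull s.1 t.2) :> split_monoid.
Proof. by []. Qed.

(** Over an idempotent [e] the powers of [(e, T)] stabilize at the third: writing the actions as
    products, the second entry is then the union of [T e], [e T e] and [e T]. *)
Lemma split_malcev (V : finMonoidType -> Prop) : V N -> aperiodic_malcev V split_monoid.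
Proof.
move=> VN; exists N, (fun s => [set s.1]); split=> //.
  split=> [s||s s' n n']; rewrite ?set11//; first by apply/set0Pn; exists s.1; rewrite inE.
  by move=> /set1P-> /set1P->; rewrite inE.
move=> e ee; apply: expg_aperiodic => -[n T]; rewrite !inE /= => /eqP <-; exists 3%N.
rewrite !expgS !mulg1 !split_mulE /= !ee !split_mullU !split_mullA !ee.
by rewrite (setUA (split_mull e (split_mulr T e)) (split_mull e (split_mulr T e))) setUid.
Qed.
End SplitMonoid.

(** * Refining a relational morphism by factorizations *)

Section Refinement.
Variables (M N : finMonoidType) (phi : M -> {set N}).
Hypothesis rphi : relational_morphism phi.

(** The pair [(s.1, 1)] comes from the factorization of a nonempty word with an empty
    second factor; it turns an idempotent [e] into a pair [(e.1, e.1)] of [e.2]. *)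
Definition split_value (m : M) (s : split_monoid N) : Prop :=
  [/\ s.1 \in phi m,
      m = 1 /\ s = 1 \/ (s.1, 1) \in s.2
    & forall a b, (a, b) \in s.2 ->
        exists m1 m2, [/\ m = m1 * m2, a \in phi m1 & b \in phi m2]].

Definition split_phi (m : M) : {set split_monoid N} := [set s | `[< split_value m s >]].

(** A pair coming from [s] cuts [m * m'] inside [m], and one coming from [s'] cuts it inside
    [m']. *)
Lemma split_phi_relational : relational_morphism split_phi.
Proof.
have [phi0 phi1 phiM] := rphi; split=> [m||m m' s s'].
- have /set0Pn[n mn] := phi0 m; apply/set0Pn; exists (n, [set (n, 1)]).
  rewrite inE; apply/asboolP; split; rewrite ?inE//=; first by right.
  by move=> a b /set1P[-> ->]; exists m, 1; rewrite mulg1.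
- by rewrite inE; apply/asboolP; split=> //=; [left|move=> a b; rewrite inE].
rewrite !inE => /asboolP[sm s1 sT] /asboolP[sm' s1' sT']; apply/asboolP; split.
- exact: phiM.
- case: s1 => [[-> ->]|s1]; first by rewrite !mul1g.
  case: s1' => [[-> ->]|s1']; first by rewrite !mulg1; right.
  right; rewrite split_mulE /= inE; apply/orP; right; apply/imsetP.
  by exists (s'.1, 1).
move=> a b; rewrite split_mulE /= inE => /orP[] /imsetP[[c d] /= cd [-> ->]].
  have [m1 [m2 [-> c1 d2]]] := sT _ _ cd.
  by exists m1, (m2 * m'); rewrite -mulgA; split=> //; exact: phiM.
have [m1 [m2 [-> c1 d2]]] := sT' _ _ cd.
by exists (m * m1), m2; rewrite mulgA; split=> //; exact: phiM.
Qed.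

Lemma split_phi_idempotent (e : split_monoid N) : Defs.idempotent e ->
  Defs.idempotent e.1 /\
  rel_preim split_phi e \subset smul (rel_preim phi e.1) (rel_preim phi e.1).
Proof.
have [_ phi1 _] := rphi; rewrite /Defs.idempotent split_mulE => ee.
split; first by rewrite -[in RHS]ee.
apply/subsetP => m; rewrite !inE => /asboolP[_ [[-> ->]|e1] eT].
  by apply/smulP; exists 1, 1; rewrite mulg1 !inE.
have /eT[m1 [m2 [-> em1 em2]]] : (e.1, e.1) \in e.2.
  rewrite -[in X in _ \in X]ee inE; apply/orP; left; apply/imsetP.
  by exists (e.1, 1); rewrite ?mul1g.
by apply: mem_smul; rewrite inE.
Qed.
End Refinement.

Section Stabilization.
Variable M : finMonoidType.
Let sq (X : {set M}) := smul X X.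

(** The iterates decrease and lose an element at each strict step, so after [#|M|] squarings the set
    is stable or empty, and the empty set is stable too. *)
Lemma iter_smul_stable (X : {set M}) : sq X \subset X ->
  iter #|M| sq X \subset X /\ sq (iter #|M| sq X) = iter #|M| sq X.
Proof.
move=> sX.
have decr j : iter j.+1 sq X \subset iter j sq X.
  by elim: j => //= j IHj; apply: smulS.
split; first by elim: #|M| => //= j; apply: subset_trans (decr j).
have small j : sq (iter j sq X) = iter j sq X \/ #|iter j sq X| + j <= #|M|.
  elim: j => [|j [fix_j|small]]; first by right; rewrite addn0 max_card.
    by left; rewrite /= fix_j.
  have [eq_j|neq_j] := eqVneq (iter j.+1 sq X) (iter j sq X).
    by left; rewrite /= in eq_j *; rewrite eq_j.
  right; apply: leq_trans small; rewrite addnS ltn_add2r.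
  by apply: proper_card; rewrite properEneq neq_j decr.
have [//|] := small #|M|; rewrite -[leqRHS]add0n leq_add2r leqn0 cards_eq0 => /eqP->.
by apply/setP => x; rewrite inE; apply/smulP => -[y [z []]]; rewrite inE.
Qed.

End Stabilization.

(** * Characterization of idempotent pointlike sets *)

Section IdempotentPointlike.
Variable V : finMonoidType -> Prop.
Hypotheses (pvV : pseudovariety V) (mV : forall M, V M <-> aperiodic_malcev V M).
Variable M : finMonoidType.
Let sq (X : {set M}) := smul X X.

(** Every set that is not pointlike is excluded by some relational morphism; the product of these
    finitely many morphisms excludes them all, the preimage of a pair being the intersection of the
    preimages. *)
Lemma exact_morphism : exists (N : finMonoidType) (phi : M -> {set N}),
  [/\ V N, relational_morphism phi & forall n, pointlike V (rel_preim phi n)].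
Proof.
have [N [phi [VN rphi phiP]]] : exists (N : finMonoidType) (phi : M -> {set N}),
    [/\ V N, relational_morphism phi &
      forall Z n, Z \in enum {: {set M}} -> Z \subset rel_preim phi n -> pointlike V Z].
  elim: (enum _) => [|Z s [N [phi [VN rphi phiP]]]].
    exists unit, (fun=> setT); split=> //.
      by apply: (pv_trivial pvV); rewrite card_unit.
    by split=> *; rewrite ?inE//; apply/set0Pn; exists tt.
  have [plZ|nplZ] := pselect (pointlike V Z).
    by exists N, phi; split=> // Z' n; rewrite inE => /orP[/eqP->//|]; exact: phiP.
  have [N' [phi' [VN' rphi' phi'Z]]] : exists (N' : finMonoidType) (phi' : M -> {set N'}),
      [/\ V N', relational_morphism phi' & forall n, ~ Z \subset rel_preim phi' n].
    apply: contrapT => noN; apply: nplZ => N' phi' VN' rphi'.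
    apply: contrapT => non; apply: noN; exists N', phi'; split=> // n Zn.
    by apply: non; exists n.
  exists (N * N')%type, (fun m => setX (phi m) (phi' m)); split.
  - exact: (pv_prod pvV).
  - case: rphi rphi' => [p0 p1 pM] [p0' p1' pM']; split=> [m||m m' [n k] [n' k']].
    + have /set0Pn[n mn] := p0 m; have /set0Pn[n' mn'] := p0' m.
      by apply/set0Pn; exists (n, n'); rewrite !inE mn.
    + by rewrite !inE p1.
    rewrite !inE /= => /andP[mn mk] /andP[mn' mk'].
    by apply/andP; split; [exact: pM|exact: pM'].
  move=> Z' [n n'] + /subsetP Zn; rewrite inE => /orP[/eqP ZZ|sZ].
    by case: (phi'Z n'); rewrite -ZZ; apply/subsetP => z /Zn; rewrite !inE => /andP[].
  by apply: (phiP Z' n sZ); apply/subsetP => z /Zn; rewrite !inE => /andP[].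
by exists N, phi; split=> // n; apply: (phiP _ n) (subxx _); rewrite mem_enum.
Qed.

(** Each refinement stays in [V] by closure under the Mal'cev product and adds one squaring. *)
Lemma iterated_refinement (N : finMonoidType) (phi : M -> {set N}) j :
  V N -> relational_morphism phi ->
  exists (N' : finMonoidType) (phi' : M -> {set N'}),
    [/\ V N', relational_morphism phi' & forall e', Defs.idempotent e' ->
      exists2 e, Defs.idempotent e & rel_preim phi' e' \subset iter j sq (rel_preim phi e)].
Proof.
move=> VN rphi; elim: j => [|j [N' [phi' [VN' rphi' phi'P]]]].
  by exists N, phi; split=> // e ee; exists e.
exists (split_monoid N'), (split_phi phi'); split.
- exact/mV/split_malcev.
- exact: split_phi_relational.
move=> e' /(split_phi_idempotent rphi')[/phi'P[e ee sub_e] sub_e'].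
by exists e => //; apply: subset_trans sub_e' _; apply: smulS.
Qed.

Theorem idempotent_pointlikeP (Z : {set M}) : idempotent_pointlike V Z <->
  exists E, [/\ pointlike V E, smul E E = E & Z \subset E].
Proof.
split=> [iplZ|[E [plE EE ZE]] N phi VN rphi]; last first.
  have [n En] := plE N phi VN rphi.
  have EX k : (E : powerset_monoid M) ^+ k.+1 = E :> {set M}.
    by elim: k => // k IHk; rewrite expgS; apply: etrans EE; congr smul.
  have [k [p [p_gt0 np]]] := expg_period n.
  (* A multiple of the period that is at least [k], so this power of [n] is idempotent; with [k.+1]
     it is positive even for [k = 0], so the same power of [E] is [E]. *)
  exists (n ^+ (k.+1 * p)).
    by rewrite /Defs.idempotent -expgnDr np//; nia.
  apply: (subset_trans ZE); have := rel_preimX (k.+1 * p) rphi (X := E) En.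
  by rewrite -[in (E : powerset_monoid M) ^+ _](@prednK (k.+1 * p)) ?EX// muln_gt0.
(* After [#|M|] refinements of an exact morphism, [Z] lies in the stable power of some
   [rel_preim phi e], which is pointlike as a part of a pointlike set. *)
have [N [phi [VN rphi phiP]]] := exact_morphism.
have [N' [phi' [VN' rphi' phi'P]]] := iterated_refinement #|M| VN rphi.
have [e' /phi'P[e ee sub_e] Ze'] := iplZ N' phi' VN' rphi'.
have [|sub_X fix_X] := @iter_smul_stable M (rel_preim phi e).
  apply/subsetP => _ /smulP[x [y [ex ey ->]]]; rewrite !inE in ex ey *.
  by rewrite -ee; case: rphi => _ _; apply.
exists (iter #|M| sq (rel_preim phi e)); split=> //; last exact: subset_trans sub_e.
move=> N1 phi1 VN1 rphi1; have [n Xn] := phiP e N1 phi1 VN1 rphi1.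
by exists n; apply: subset_trans Xn.
Qed.

End IdempotentPointlike.

Theorem corollary4p6 :
  (forall V : finMonoidType -> Prop,
     pseudovariety V ->
     (forall M : finMonoidType, V M <-> aperiodic_malcev V M) ->
     decidable_subsets (pointlike V) ->
     decidable_subsets (idempotent_pointlike V)) /\
  decidable_subsets (idempotent_pointlike aperiodic_monoid).
Proof.
have general V : pseudovariety V -> (forall M, V M <-> aperiodic_malcev V M) ->
    decidable_subsets (pointlike V) -> decidable_subsets (idempotent_pointlike V).
  move=> pvV mV /decidable_below_idempotent[f rf fP]; exists f => // M n r r_bij Z.
  by rewrite fP//; split=> /(idempotent_pointlikeP pvV mV).
split=> //; apply: general decidable_aperiodic_pointlike.
  exact: aperiodic_pseudovariety.
exact: aperiodic_malcev_fixed.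
Qed.
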